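(* Let $X$ be a Polish space, let $\mathscr{H}(K)$ be a reproducing kernel Hilbert space of Borel measurable functions $X\to\mathbb{F}$ with feature map $\phi(x)=k_x$, let $\mu$ be a Borel probability measure on $X$, let $1<p<\infty$ and $\lambda>0$. Let $g:X\to\mathbb{F}$ and $c:\mathbb{F}\times\mathbb{F}\to\mathbb{R}^+=[0,\infty)$ be Borel measurable functions such that $c(0,g(\cdot))\in L^1(X,\mu)$ and, for every $z\in\mathbb{F}$, $c(\cdot,z)$ is lower semicontinuous and convex. Let $\hat f\in\mathscr{H}(K)$ be the unique optimizer of $$\inf_{f\in\mathscr{H}(K)} \int_X c(f(x),g(x))\,d\mu(x)+\lambda\|f\|_{\mathscr{H}(K)}^p .$$ Assume that $\mu$ satisfies: for every $\mathbb{F}$-measure $\xi$ on $X$ with $\operatorname{supp}(\xi)\subset\operatorname{supp}(\mu)$, $$\int_X\|\phi(x)\|_{\mathscr{H}(K)}\,d|\xi|(x)<+\infty .$$ Then there exists a sequence of $\mathbb{F}$-measures $\{\nu_n\}_{n=1}^\infty$ on $X$ with $\operatorname{supp}(\nu_n)\subset\operatorname{supp}(\mu)$ for all $n$ such that $$\hat f=\lim_{n\to\infty}\int_X\phi(x)\,d\nu_n(x)$$ (limit in the norm of $\mathscr{H}(K)$). Furthermore, if $\mu$ is finitely supported, or $\mathscr{H}(K)$ is finite-dimensional, then there exists an $\mathbb{F}$-measure $\nu$ on $X$ with $\operatorname{supp}(\nu)\subset\operatorname{supp}(\mu)$ such that $$\hat f=\int_X\phi(x)\,d\nu(x).$$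
   Context: $\mathbb{F}=\mathbb{R}$ or $\mathbb{C}$. A reproducing kernel Hilbert space (RKHS) on $X$ is a vector subspace $\mathscr{H}$ of the space of all functions $X\to\mathbb{F}$ equipped with a Hilbert space inner product $\langle\cdot,\cdot\rangle$ ($\mathbb{F}$-linear in the first argument) such that each evaluation functional $f\mapsto f(x)$ is bounded. For $x\in X$, $k_x\in\mathscr{H}$ is the unique vector with $f(x)=\langle f,k_x\rangle$ for all $f\in\mathscr{H}$; the reproducing kernel is $K(y,x)=k_x(y)$, and $\mathscr{H}(K)$ denotes the RKHS with reproducing kernel $K$. Standing assumptions: $X$ is a Polish space, and all functions and measures are Borel measurable. An $\mathbb{F}$-measure on $X$ is a complex Borel measure if $\mathbb{F}=\mathbb{C}$ and a (finite, real-valued) signed Borel measure if $\mathbb{F}=\mathbb{R}$; $|\xi|$ is the variation measure of $\xi$, and $\operatorname{supp}(\xi)$ is the support of $|\xi|$. For an $\mathbb{F}$-measure $\xi$ with $\int_X\|\phi\|_{\mathscr{H}(K)}\,d|\xi|<\infty$, $\int_X\phi\,d\xi\in\mathscr{H}(K)$ is the Pettis integral, i.e. the element determined by $\langle\int_X\phi(x)\,d\xi(x),f\rangle_{\mathscr{H}(K)}=\int_X\langle\phi(x),f\rangle_{\mathscr{H}(K)}\,d\xi(x)$ for all $f\in\mathscr{H}(K)$. Under the stated hypotheses on $c,g,p,\lambda$ the minimization problem has exactly one optimizer in $\mathscr{H}(K)$. *)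

(* Defs.v *)
From HB Require Import structures.
From mathcomp Require Import all_boot all_order all_algebra.
From mathcomp Require Import complex.
From mathcomp Require Import all_classical all_reals all_analysis.

Set Implicit Arguments.
Unset Strict Implicit.
Unset Printing Implicit Defensive.

Import Order.TTheory GRing.Theory Num.Theory.
Import numFieldNormedType.Exports.

Local Open Scope classical_set_scope.
Local Open Scope ring_scope.

Variant scalar_kind := RealScalars | ComplexScalars.

Definition scalar_field (R : realType) (k : scalar_kind) : numFieldType :=
  match k with RealScalars => R | ComplexScalars => R[i] end.

Section Scalars.
Context (R : realType).

Definition sre k : scalar_field R k -> R :=
  match k with RealScalars => id | ComplexScalars => @complex.Re R end.

Definition sim k : scalar_field R k -> R :=
  match k with RealScalars => fun=> 0 | ComplexScalars => @complex.Im R end.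

Definition sconj k : scalar_field R k -> scalar_field R k :=
  match k with RealScalars => id | ComplexScalars => @conjc R end.

(* a + i b, where b is dropped for real scalars *)
Definition mkscalar k : R -> R -> scalar_field R k :=
  match k with RealScalars => fun a _ => a | ComplexScalars => @Complex R end.

Definition of_real k (a : R) : scalar_field R k := mkscalar k a 0.

(* the library's norm on [R[i]] takes its values in [R[i]]; this is the same
   norm with values in [R] *)
Definition smod k (z : scalar_field R k) : R := sre `|z|.

Lemma sreD k (x y : scalar_field R k) : sre (x + y) = sre x + sre y.
Proof. by case: k x y => //= -[? ?] [? ?]. Qed.

Lemma simD k (x y : scalar_field R k) : sim (x + y) = sim x + sim y.
Proof. by case: k x y => [? ?|[? ?] [? ?]] //=; rewrite addr0. Qed.

Lemma sre0 k : sre (0 : scalar_field R k) = 0. Proof. by case: k. Qed.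

Lemma sim0 k : sim (0 : scalar_field R k) = 0. Proof. by case: k. Qed.

Lemma sre_sum k n (f : nat -> scalar_field R k) :
  sre (\sum_(0 <= i < n) f i) = \sum_(0 <= i < n) sre (f i).
Proof. by apply: big_morph; [exact: sreD|exact: sre0]. Qed.

Lemma sim_sum k n (f : nat -> scalar_field R k) :
  sim (\sum_(0 <= i < n) f i) = \sum_(0 <= i < n) sim (f i).
Proof. by apply: big_morph; [exact: simD|exact: sim0]. Qed.

Lemma sre_contract k (x y : scalar_field R k) (e : R) :
  `|x - y| < of_real k e -> `|sre x - sre y| < e.
Proof.
case: k x y => // -[a b] [c d]; rewrite /of_real /= normc_def ltcR /=.
apply: le_lt_trans; rewrite -sqrtr_sqr ler_wsqrtr //.
by rewrite lerDl sqr_ge0.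
Qed.

Lemma sim_contract k (x y : scalar_field R k) (e : R) : 0 < e ->
  `|x - y| < of_real k e -> `|sim x - sim y| < e.
Proof.
case: k x y => [x y e0 _|]; first by rewrite /= subrr normr0.
move=> -[a b] [c d] _; rewrite /of_real /= normc_def ltcR /=.
apply: le_lt_trans; rewrite -sqrtr_sqr ler_wsqrtr //.
by rewrite lerDr sqr_ge0.
Qed.

Lemma of_real_gt0 k (e : R) : 0 < e -> 0 < of_real k e.
Proof. by case: k => //= e0; rewrite /of_real /= ltcR. Qed.

Lemma cvg_sre k (u : nat -> scalar_field R k) (l : scalar_field R k) :
  u @ \oo --> l -> (@sre k \o u) @ \oo --> sre l.
Proof.
move=> /cvgrPdist_lt ul; apply/cvgrPdist_lt => e e0.
have := ul _ (of_real_gt0 k e0); apply: filterS => n; exact: sre_contract.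
Qed.

Lemma cvg_sim k (u : nat -> scalar_field R k) (l : scalar_field R k) :
  u @ \oo --> l -> (@sim k \o u) @ \oo --> sim l.
Proof.
move=> /cvgrPdist_lt ul; apply/cvgrPdist_lt => e e0.
have := ul _ (of_real_gt0 k e0); apply: filterS => n; exact: sim_contract.
Qed.

End Scalars.

Definition polish (R : realType) (X : topologicalType) : Prop :=
  (exists D : set X, countable D /\ dense D) /\
  exists d : X -> X -> R,
    [/\ forall x y, d x y = 0 <-> x = y,
        forall x y, d x y = d y x,
        forall x y z, d x z <= d x y + d y z,
        forall x, nbhs x =
          filter_from [set e : R | 0 < e] (fun e => [set y | d x y < e]) &
        forall u : nat -> X,
          (forall e : R, 0 < e -> exists N, forall m n,
             (N <= m)%N -> (N <= n)%N -> d (u m) (u n) < e) ->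
          exists l : X, u @ \oo --> l].

(* A type synonym of [X] whose measurable sets are the Borel sets of [X]. *)
Notation borel X := (g_sigma_algebraType (@open X)).

Section BorelMeasures.
Context (R : realType) (k : scalar_kind) (X : ptopologicalType).
Local Notation F := (scalar_field R k).

(* Only the values on Borel sets are meaningful. *)
Record fmeasure := FMeasure {
  fmeas :> set (borel X) -> F ;
  fmeas0 : fmeas set0 = 0 ;
  fmeas_sigma_additive : forall A : (set (borel X))^nat,
    (forall n, measurable (A n)) -> trivIset setT A ->
    (fun n => \sum_(0 <= i < n) fmeas (A i)) @ \oo --> fmeas (\bigcup_n A n) }.

(* total variation: countable Borel partitions, as for complex measures *)
Definition fvariation (xi : fmeasure) (A : set (borel X)) : \bar R :=
  ereal_sup [set (\sum_(0 <= i <oo) (smod (xi (E i)))%:E)%E | E in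
    [set E : (set (borel X))^nat |
      [/\ forall i, measurable (E i), trivIset setT E & \bigcup_i E i = A]]].

Definition supp (m : set (borel X) -> \bar R) : set X :=
  [set x | forall U : set X, open U -> U x -> (0 < m U)%E].

Definition fmeas_re (xi : fmeasure) (A : set (borel X)) : \bar R :=
  (sre (xi A))%:E.

Definition fmeas_im (xi : fmeasure) (A : set (borel X)) : \bar R :=
  (sim (xi A))%:E.

Section Charges.
Variable xi : fmeasure.

Let re0 : fmeas_re xi set0 = 0%E.
Proof. by rewrite /fmeas_re fmeas0 sre0. Qed.

Let re_fin A : measurable A -> fmeas_re xi A \is a fin_num.
Proof. by []. Qed.

Let re_sigma_additive : semi_sigma_additive (fmeas_re xi).
Proof.
move=> A mA tA _.
under eq_fun do rewrite sumEFin -sre_sum.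
by apply: cvg_EFin => //; [near=> n|exact: cvg_sre (fmeas_sigma_additive mA tA)].
Unshelve. all: by end_near. Qed.

HB.instance Definition _ := isCharge.Build _ (borel X) R (fmeas_re xi)
  re0 re_fin re_sigma_additive.

Let im0 : fmeas_im xi set0 = 0%E.
Proof. by rewrite /fmeas_im fmeas0 sim0. Qed.

Let im_fin A : measurable A -> fmeas_im xi A \is a fin_num.
Proof. by []. Qed.

Let im_sigma_additive : semi_sigma_additive (fmeas_im xi).
Proof.
move=> A mA tA _.
under eq_fun do rewrite sumEFin -sim_sum.
by apply: cvg_EFin => //; [near=> n|exact: cvg_sim (fmeas_sigma_additive mA tA)].
Unshelve. all: by end_near. Qed.

HB.instance Definition _ := isCharge.Build _ (borel X) R (fmeas_im xi)
  im0 im_fin im_sigma_additive.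

End Charges.

Definition hahn_pos (nu : {charge set (borel X) -> \bar R}) : set (borel X) :=
  sval (cid (Hahn_decomposition nu)).

Definition hahn_neg (nu : {charge set (borel X) -> \bar R}) : set (borel X) :=
  sval (cid (svalP (cid (Hahn_decomposition nu)))).

Lemma hahnP (nu : {charge set (borel X) -> \bar R}) :
  hahn_decomposition nu (hahn_pos nu) (hahn_neg nu).
Proof. exact: svalP. Qed.

(* the value does not depend on the Hahn decomposition chosen *)
Definition charge_integral (nu : {charge set (borel X) -> \bar R})
    (u : X -> R) : R :=
  Rintegral (jordan_pos (hahnP nu)) setT u -
  Rintegral (jordan_neg (hahnP nu)) setT u.

(* the expansion of the integral of (re u + i im u) d(re xi + i im xi) *)
Definition fintegral (xi : fmeasure) (u : X -> F) : F :=
  let re_xi : {charge set (borel X) -> \bar R} := fmeas_re xi in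
  let im_xi : {charge set (borel X) -> \bar R} := fmeas_im xi in
  let re_u := (@sre R k) \o u in
  let im_u := (@sim R k) \o u in
  mkscalar k (charge_integral re_xi re_u - charge_integral im_xi im_u)
             (charge_integral re_xi im_u + charge_integral im_xi re_u).

End BorelMeasures.

Section ReproducingKernel.
Context (R : realType) (k : scalar_kind).
Local Notation F := (scalar_field R k).

Definition norm_of (V : Type) (ip : V -> V -> F) (f : V) : R :=
  Num.sqrt (sre (ip f f)).

(* [ip] is only meaningful on [rkhs_set]; note that [0 <= z] in [R[i]] entails
   that [z] is real. *)
Record rkhs (X : Type) := RKHS {
  rkhs_set :> (X -> F) -> Prop ;
  ip : (X -> F) -> (X -> F) -> F ;
  rkhs0 : rkhs_set (fun=> 0) ;
  rkhsD : forall f g, rkhs_set f -> rkhs_set g -> rkhs_set (f \+ g) ;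
  rkhsZ : forall (a : F) f, rkhs_set f -> rkhs_set (fun x => a * f x) ;
  ipD : forall f g h, rkhs_set f -> rkhs_set g -> rkhs_set h ->
    ip (f \+ g) h = ip f h + ip g h ;
  ipZ : forall (a : F) f h, rkhs_set f -> rkhs_set h ->
    ip (fun x => a * f x) h = a * ip f h ;
  ipC : forall f g, rkhs_set f -> rkhs_set g -> ip f g = sconj (ip g f) ;
  ip_ge0 : forall f, rkhs_set f -> 0 <= ip f f ;
  ip_eq0 : forall f, rkhs_set f -> ip f f = 0 -> f = fun=> 0 ;
  rkhs_complete : forall u : nat -> X -> F, (forall n, rkhs_set (u n)) ->
    (forall e : R, 0 < e -> exists N, forall m n,
       (N <= m)%N -> (N <= n)%N -> norm_of ip (u m \- u n) < e) ->
    exists2 f, rkhs_set f &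
      (fun n => norm_of ip (u n \- f)) @ \oo --> (0 : R) ;
  rkhs_eval_bounded : forall x, exists M : R,
    forall f, rkhs_set f -> smod (f x) <= M * norm_of ip f }.

Definition hnorm (X : Type) (H : rkhs X) (f : X -> F) : R := norm_of (ip H) f.

(* phi x is the representer k_x of evaluation at x *)
Definition is_feature_map (X : Type) (H : rkhs X) (phi : X -> X -> F) : Prop :=
  forall x, H (phi x) /\ forall f, H f -> f x = ip H f (phi x).

Definition finite_dimensional (X : Type) (H : rkhs X) : Prop :=
  exists (n : nat) (e : 'I_n -> X -> F), (forall i, H (e i)) /\
    forall f, H f -> exists a : 'I_n -> F,
      f = fun x => \sum_(i < n) a i * e i x.

Section Integrals.
Context (X : ptopologicalType) (H : rkhs X).

(* [h] is the Pettis integral of [phi] against [xi] *)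
Definition is_pettis_integral (phi : X -> X -> F) (xi : fmeasure R k X)
    (h : X -> F) : Prop :=
  [/\ (\int[fvariation xi]_x (hnorm H (phi x))%:E < +oo)%E, H h &
      forall f, H f -> ip H h f = fintegral xi (fun x => ip H (phi x) f)].

Definition objective (mu : probability (borel X) R) (c : F -> F -> R)
    (g : X -> F) (lambda p : R) (f : X -> F) : \bar R :=
  (\int[mu]_x (c (f x) (g x))%:E + (lambda * hnorm H f `^ p)%:E)%E.

Definition is_optimizer (mu : probability (borel X) R) (c : F -> F -> R)
    (g : X -> F) (lambda p : R) (fhat : X -> F) : Prop :=
  H fhat /\
  forall f, H f -> (objective mu c g lambda p fhat <=
                    objective mu c g lambda p f)%E.

End Integrals.

End ReproducingKernel.

Definition convex_fun (R : realType) (k : scalar_kind)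
    (f : scalar_field R k -> R) : Prop :=
  forall (t : R) (w z : scalar_field R k), 0 <= t <= 1 ->
    f (of_real k t * w + of_real k (1 - t) * z) <= t * f w + (1 - t) * f z.

(* Main.v *)
(** Let [q] be the orthogonal projection of the optimizer on the closed span of
    the representers [phi x] with [x] in [supp mu]. By the reproducing property
    [fhat - q] vanishes on [supp mu], which has full measure because [X] is second
    countable, so [fhat] and [q] have the same data term; since the norm of [q]
    is not larger, optimality forces [fhat = q]. Hence [fhat] is a limit of finite
    combinations of representers, i.e. of integrals of [phi] against finitely
    supported measures. If [supp mu] is finite or [H] is finite-dimensional,
    finitely many points of [supp mu] determine the restrictions to [supp mu] of
    all functions of [H], and interpolating [fhat] there by a combination of the
    corresponding representers gives the projection exactly. *)

Require Import Defs.
From mathcomp Require Import all_boot all_order all_algebra.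
From mathcomp Require Import all_classical all_reals all_analysis.
From mathcomp Require Import measurable_realfun complex ring lra.

Import Order.TTheory GRing.Theory Num.Theory.
Import numFieldNormedType.Exports.

Local Open Scope classical_set_scope.
Local Open Scope ring_scope.

Set Implicit Arguments.
Unset Strict Implicit.
Unset Printing Implicit Defensive.

(** * Real and complex scalars treated uniformly *)

Section ScalarTheory.
Context {R : realType} {k : scalar_kind}.
Implicit Types (t : R) (w z : scalar_field R k).

Lemma sreN z : sre (- z) = - sre z.
Proof. by case: k z => //= -[]. Qed.

Lemma sreB w z : sre (w - z) = sre w - sre z.
Proof. by rewrite sreD sreN. Qed.

Lemma sre_of_realM t z : sre (of_real k t * z) = t * sre z.
Proof. by case: k z => [z|[a b]] //=; rewrite mul0r subr0. Qed.

Lemma sreM w z : sre (w * z) = sre w * sre z - sim w * sim z.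
Proof. by case: k w z => [w z|[a b] [c d]] //=; rewrite mulr0 subr0. Qed.

Lemma simM w z : sim (w * z) = sre w * sim z + sim w * sre z.
Proof. by case: k w z => [w z|[a b] [c d]] //=; rewrite mulr0 mul0r addr0. Qed.

Lemma mkscalarE z : mkscalar k (sre z) (sim z) = z.
Proof. by case: k z => [z|[a b]]. Qed.

Lemma sre_conj z : sre (sconj z) = sre z.
Proof. by case: k z => [z|[a b]]. Qed.

Lemma sim_conj z : sim (sconj z) = - sim z.
Proof. by case: k z => [z|[a b]] //=; rewrite oppr0. Qed.

(** Lets [ring] treat [of_real k 2^-1] as an opaque coefficient in the midpoint identity of
    [projection]. *)
Lemma split_half z : z = of_real k 2^-1 * z + of_real k 2^-1 * z.
Proof.
rewrite -mulrDl -[LHS]mul1r; congr (_ * z); rewrite /of_real.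
case: k => /=; first by field.
by apply/eqP; rewrite eq_complex /= addr0 eqxx andbT; apply/eqP; field.
Qed.

Lemma sconj0 : sconj (0 : scalar_field R k) = 0.
Proof. by case: k => //; rewrite /= oppr0. Qed.

Lemma sre_ge0 z : 0 <= z -> 0 <= sre z.
Proof. by case: k z => [z|[a b]] //=; rewrite lecE /= => /andP[]. Qed.

Lemma sre_eq0 z : 0 <= z -> sre z = 0 -> z = 0.
Proof.
case: k z => [z|[a b]] //=; rewrite lecE /= => /andP[/eqP + _] ->.
by move=> ->.
Qed.

(** The real part of [sconj z * z] is the squared modulus of [z]. *)
Lemma sre_conjM_eq0 z : sre (sconj z * z) = 0 -> z = 0.
Proof.
case: k z => [z|[a b]] /= /eqP; first by rewrite mulf_eq0 orbb => /eqP.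
rewrite mulNr opprK paddr_eq0 -?expr2 ?sqr_ge0 //.
by rewrite !sqrf_eq0 => /andP[/eqP-> /eqP->].
Qed.

Lemma smod0 : smod (0 : scalar_field R k) = 0.
Proof. by rewrite /smod normr0 sre0. Qed.

End ScalarTheory.

(** * Hilbert space geometry through the real inner product *)

Section HilbertTheory.
Context {R : realType} {k : scalar_kind} {X : Type} {H : rkhs R k X}.
Local Notation F := (scalar_field R k).
Implicit Types (f g h : X -> F) (t : R) (a : F).

(** The real part gives the same norm and a real inner product, so the quadratic arguments below run
    over real parameters [t]. *)
Definition reip f g : R := sre (ip H f g).

Lemma sub_funE f g : f \- g = f \+ (fun x => -1 * g x).
Proof. by apply/funext => x /=; rewrite mulN1r. Qed.

Lemma rkhsB f g : H f -> H g -> H (f \- g).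
Proof. by move=> Hf Hg; rewrite sub_funE; apply: rkhsD => //; exact: rkhsZ. Qed.

Lemma rkhs_sum (I : Type) (s : seq I) (v : I -> X -> F) :
  (forall i, H (v i)) -> H (fun x => \sum_(i <- s) v i x).
Proof.
move=> Hv; elim: s => [|i s IHs].
  by under eq_fun do rewrite big_nil; exact: rkhs0.
by under eq_fun do rewrite big_cons; exact: rkhsD.
Qed.

Lemma ip0l g : H g -> ip H (fun=> 0) g = 0.
Proof.
move=> Hg; have := @ipZ _ _ _ H 0 _ _ Hg Hg; rewrite mul0r.
by under eq_fun do rewrite mul0r.
Qed.

Lemma ip_sum (I : Type) (s : seq I) (a : I -> F) (v : I -> X -> F) g :
  (forall i, H (v i)) -> H g ->
  ip H (fun x => \sum_(i <- s) a i * v i x) g = \sum_(i <- s) a i * ip H (v i) g.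
Proof.
move=> Hv Hg; elim: s => [|i s IHs].
  by under eq_fun do rewrite big_nil; rewrite big_nil ip0l.
under eq_fun do rewrite big_cons.
rewrite big_cons -IHs -(ipZ (a i) (Hv i) Hg) -ipD //; first exact: rkhsZ.
by apply: rkhs_sum => j; exact: rkhsZ.
Qed.

Lemma reipC f g : H f -> H g -> reip f g = reip g f.
Proof. by move=> Hf Hg; rewrite /reip ipC // sre_conj. Qed.

Lemma reipZl t f h : H f -> H h ->
  reip (fun x => of_real k t * f x) h = t * reip f h.
Proof. by move=> Hf Hh; rewrite /reip ipZ // sre_of_realM. Qed.

Lemma ipBl f g h : H f -> H g -> H h -> ip H (f \- g) h = ip H f h - ip H g h.
Proof.
move=> Hf Hg Hh; rewrite sub_funE.
by rewrite ipD // ?ipZ ?mulN1r //; exact: rkhsZ.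
Qed.

Lemma reipBl f g h : H f -> H g -> H h -> reip (f \- g) h = reip f h - reip g h.
Proof. by move=> Hf Hg Hh; rewrite /reip ipBl // sreB. Qed.

Lemma reipBr f g h : H f -> H g -> H h -> reip h (f \- g) = reip h f - reip h g.
Proof.
move=> Hf Hg Hh; rewrite reipC // ?reipBl // ?[reip f h]reipC ?[reip g h]reipC //.
exact: rkhsB.
Qed.

Lemma reip_ge0 f : H f -> 0 <= reip f f.
Proof. by move=> Hf; apply/sre_ge0/ip_ge0. Qed.

Lemma reip_eq0 f : H f -> reip f f = 0 -> f = fun=> 0.
Proof. by move=> Hf f0; apply: (ip_eq0 Hf); apply: sre_eq0 => //; exact: ip_ge0. Qed.

Lemma reipBB f g : H f -> H g ->
  reip (f \- g) (f \- g) = reip f f - 2 * reip f g + reip g g.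
Proof.
move=> Hf Hg; have Hfg := rkhsB Hf Hg.
by rewrite reipBl // !reipBr // (reipC Hg Hf); lra.
Qed.

Lemma reipBZ f g t : H f -> H g ->
  reip (f \- (fun x => of_real k t * g x)) (f \- (fun x => of_real k t * g x)) =
  reip f f - 2 * t * reip f g + t ^+ 2 * reip g g.
Proof.
move=> Hf Hg; have Htg := rkhsZ (of_real k t) Hg.
rewrite reipBB // reipZl // (reipC Hg Htg) (reipC Hf Htg) !reipZl // (reipC Hg Hf).
by rewrite expr2; lra.
Qed.

(** Discriminant bound: for [s > 0] take the optimal [t = r / s]; for [s = 0] a nonzero [r] is
    refuted by the [t] that makes the left side [e + 1]. It yields Cauchy-Schwarz and, with [e]
    small, the approximate orthogonality of a minimizing sequence. *)
Lemma quadratic_bound (e r s : R) : 0 <= s ->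
  (forall t, 2 * t * r <= e + t ^+ 2 * s) -> r ^+ 2 <= e * s.
Proof.
rewrite le_eqVlt => /predU1P[<-|s0] q.
  rewrite mulr0; suff -> : r = 0 by rewrite expr0n.
  apply/eqP/negP => /negP r0.
  have := q ((e + 1) / (2 * r)).
  by rewrite mulr0 addr0 (_ : _ * r = e + 1); [lra|field].
have := q (r / s); rewrite -(ler_pM2r s0).
have -> : 2 * (r / s) * r * s = 2 * r ^+ 2 by field; rewrite gt_eqF.
have -> : (e + (r / s) ^+ 2 * s) * s = e * s + r ^+ 2 by field; rewrite gt_eqF.
lra.
Qed.

Lemma reip_CauchySchwarz f g : H f -> H g ->
  reip f g ^+ 2 <= reip f f * reip g g.
Proof.
move=> Hf Hg; apply: quadratic_bound; first exact: reip_ge0.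
move=> t; have := reip_ge0 (rkhsB Hf (rkhsZ (of_real k t) Hg)).
by rewrite reipBZ //; lra.
Qed.

Lemma hnormE f : hnorm H f = Num.sqrt (reip f f).
Proof. by []. Qed.

Lemma sqr_hnorm f : H f -> hnorm H f ^+ 2 = reip f f.
Proof. by move=> Hf; rewrite hnormE sqr_sqrtr // reip_ge0. Qed.

Lemma reip_le_hnorm f g : H f -> H g -> `|reip f g| <= hnorm H f * hnorm H g.
Proof.
move=> Hf Hg; rewrite !hnormE -sqrtrM ?reip_ge0 // -sqrtr_sqr ler_wsqrtr //.
exact: reip_CauchySchwarz.
Qed.

Lemma cvg_reip (u : nat -> X -> F) f g : H g -> (forall n, H (u n)) -> H f ->
  (fun n => hnorm H (u n \- f)) @ \oo --> (0 : R) ->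
  (fun n => reip (u n) g) @ \oo --> reip f g.
Proof.
move=> Hg Hu Hf uf.
have le n : `|reip (u n) g - reip f g| <= hnorm H (u n \- f) * hnorm H g.
  by rewrite -reipBl //; apply: reip_le_hnorm => //; exact: rkhsB.
apply/subr_cvg0; apply/norm_cvg0P.
have lim0 : (fun n => hnorm H (u n \- f) * hnorm H g) @ \oo --> (0 : R).
  by rewrite -(mul0r (hnorm H g)); apply: cvgM => //; exact: cvg_cst.
apply: squeeze_cvgr (cvg_cst 0) lim0.
by apply: nearW => n; rewrite normr_ge0 le.
Qed.

Lemma hnormBC f g : H f -> H g -> hnorm H (f \- g) = hnorm H (g \- f).
Proof.
move=> Hf Hg; rewrite !hnormE !reipBB // (reipC Hg Hf).
by congr Num.sqrt; lra.
Qed.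

(** * Orthogonal projection on the closure of a subspace *)

Section Projection.
Variable W : (X -> F) -> Prop.
Hypotheses (WH : forall f, W f -> H f) (W0 : W (fun=> 0))
  (WD : forall f g, W f -> W g -> W (f \+ g))
  (WZ : forall a f, W f -> W (fun x => a * f x)).

(** [q] is the limit of a sequence in [W] minimizing the distance to [f]. Since [q] need not lie in
    [W], its own orthogonality to [f \- q] is recorded separately. *)
Lemma projection f : H f -> exists u : nat -> X -> F, exists q,
  [/\ forall n, W (u n), H q, (fun n => hnorm H (u n \- q)) @ \oo --> (0 : R),
      forall v, W v -> reip (f \- q) v = 0 & reip (f \- q) q = 0].
Proof.
move=> Hf; pose dist := [set reip (f \- h) (f \- h) | h in W].
have WfH h : W h -> H (f \- h) by move=> /WH; exact: rkhsB.
have dist_lb : lbound dist 0 by move=> _ [h Wh <-]; exact/reip_ge0/WfH.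
have dist_inf : has_inf dist.
  by split; [exists (reip (f \- fun=> 0) (f \- fun=> 0)), (fun=> 0)|exists 0].
pose d := inf dist; pose eps n : R := n.+1%:R^-1.
have d_le h : W h -> d <= reip (f \- h) (f \- h).
  by move=> Wh; apply: ge_inf; [exists 0|exists h].
have /boolp.choice[u uP] : forall n, exists h,
    W h /\ reip (f \- h) (f \- h) < d + eps n.
  move=> n; have n0 : 0 < eps n by rewrite invr_gt0 ltr0n.
  by have [_ [h Wh <-] hd] := inf_adherent n0 dist_inf; exists h.
have Wu n : W (u n) := (uP n).1.
have ud n : reip (f \- u n) (f \- u n) < d + eps n := (uP n).2.
have Hu n : H (u n) := WH (Wu n).
(* The midpoint of [u m] and [u n] lies in [W], so its squared distance to [f] is at least [d]; the
   parallelogram law turns this into a Cauchy estimate. *)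
have parallelogram m n : reip (u m \- u n) (u m \- u n) <=
    2 * (eps m + eps n).
  have := d_le _ (WZ (of_real k 2^-1) (WD (Wu m) (Wu n))).
  have -> : f \- (fun x => of_real k 2^-1 * (u m \+ u n) x) =
            f \- u m \- (fun x => of_real k 2^-1 * (u n \- u m) x).
    apply/funext => x /=.
    by rewrite [in X in _ = _ - X - _](split_half (u m x)); ring.
  have -> : u m \- u n = (f \- u n) \- (f \- u m).
    by apply/funext => x /=; ring.
  have -> : u n \- u m = (f \- u m) \- (f \- u n).
    by apply/funext => x /=; ring.
  have := ud m; have := ud n.
  have := WfH _ (Wu n); have := WfH _ (Wu m).
  set a := f \- u m; set b := f \- u n => Ha Hb bd ad.
  clearbody a b; rewrite reipBZ //; last exact: rkhsB.
  by rewrite reipBr // !reipBB // (reipC Hb Ha) expr2; lra.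
have [|q Hq uq] := rkhs_complete Hu.
  (* With both errors below [e ^+ 2 / 4], the bound [2 * (eps m + eps n)] is below [e ^+ 2]. *)
  move=> e e0; have e4 : 0 < e ^+ 2 / 4 by rewrite divr_gt0 // exprn_gt0.
  have [N _ HN] := near_infty_natSinv_lt (PosNum e4).
  have {}HN n : (N <= n)%N -> eps n < e ^+ 2 / 4 by exact: HN.
  exists N => m n /HN mN /HN nN.
  rewrite -[ltRHS]gtr0_norm // -sqrtr_sqr ltr_sqrt ?exprn_gt0 //.
  by apply: le_lt_trans (parallelogram m n) _; lra.
(* Moving [u n] by a multiple of [v] cannot bring the squared distance below [d], so
   [quadratic_bound] gives [reip (f \- u n) v ^+ 2 <= eps n * reip v v], which tends to 0. *)
have qW v : W v -> reip (f \- q) v = 0.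
  move=> Wv; have Hv := WH Wv; rewrite reipBl //; apply/eqP; rewrite subr_eq0.
  have s0 := reip_ge0 Hv; apply/eqP; apply: cvg_unique (cvg_reip Hv Hu Hq uq) => //.
  apply/subr_cvg0/cvgr0Pnorm_lt => e e0.
  (* The [+ 1] keeps the denominator positive when [v] is zero. *)
  have e1 : 0 < e ^+ 2 / (reip v v + 1) by rewrite divr_gt0 ?exprn_gt0 //; lra.
  have := near_infty_natSinv_lt (PosNum e1); apply: filterS => n /=.
  rewrite -/(eps n) ltr_pdivlMr; last lra.
  move=> ne; rewrite -normrN opprB -reipBl // -[ltRHS]gtr0_norm // -!sqrtr_sqr.
  rewrite ltr_sqrt ?exprn_gt0 //; apply: le_lt_trans ne.
  have n0 : 0 < eps n by rewrite invr_gt0 ltr0n.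
  apply: (@le_trans _ _ (eps n * reip v v)); last by rewrite ler_pM2l; lra.
  apply: quadratic_bound => // t.
  have := d_le _ (WD (Wu n) (WZ (of_real k t) Wv)).
  have -> : f \- (u n \+ (fun x => of_real k t * v x)) =
            (f \- u n) \- (fun x => of_real k t * v x).
    by apply/funext => x /=; rewrite opprD addrA.
  by rewrite reipBZ //; [have := ud n; lra|exact: WfH (Wu n)].
exists u, q; split=> //.
(* Each [u n] is orthogonal to [f \- q], and this passes to the limit [q]. *)
have Hfq := rkhsB Hf Hq; rewrite reipC //.
apply: (cvg_unique _ (cvg_reip Hfq Hu Hq uq)) => //.
rewrite (_ : (fun n => reip (u n) (f \- q)) = cst 0); first exact: cvg_cst.
by apply/funext => n; rewrite reipC ?qW.
Qed.

End Projection.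

End HilbertTheory.

(** * Finite combinations of representers and interpolation *)

Section Representers.
Context {R : realType} {k : scalar_kind} {X : choiceType} {H : rkhs R k X}.
Local Notation F := (scalar_field R k).
Variable phi : X -> X -> F.
Hypothesis phiP : is_feature_map H phi.
Implicit Types (f : X -> F) (S : set X) (s : seq (F * X)).

(** The same list of weighted points, repetitions allowed, also encodes the discrete measure against
    which [phi] integrates to this function. *)
Definition atomic_comb s : X -> F := fun x => \sum_(i <- s) i.1 * phi i.2 x.

Definition representer_span S f : Prop :=
  exists2 s, (forall i, i \in s -> S i.2) & f = atomic_comb s.

Lemma representer_rkhs x : H (phi x).
Proof. exact: (phiP x).1. Qed.

Lemma atomic_comb_rkhs s : H (atomic_comb s).
Proof. by apply: rkhs_sum => i; apply: rkhsZ; exact: representer_rkhs. Qed.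

Lemma representer_span_rkhs S f : representer_span S f -> H f.
Proof. by move=> [s _ ->]; exact: atomic_comb_rkhs. Qed.

Lemma ip_atomic_comb s f : H f ->
  ip H (atomic_comb s) f = \sum_(i <- s) i.1 * ip H (phi i.2) f.
Proof. by move=> Hf; rewrite ip_sum // => i; exact: representer_rkhs. Qed.

Lemma ip_representer x f : H f -> ip H (phi x) f = sconj (f x).
Proof.
move=> Hf; rewrite ipC //; last exact: representer_rkhs.
by rewrite -((phiP x).2 f Hf).
Qed.

Lemma representer_span0 S : representer_span S (fun=> 0).
Proof. by exists [::] => //; apply/funext => x; rewrite /atomic_comb big_nil. Qed.

Lemma representer_spanD S f g :
  representer_span S f -> representer_span S g -> representer_span S (f \+ g).
Proof.
move=> [s sS ->] [t tS ->]; exists (s ++ t) => [i|].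
  by rewrite mem_cat => /orP[/sS|/tS].
by apply/funext => x; rewrite /atomic_comb big_cat.
Qed.

Lemma representer_spanZ S (a : F) f :
  representer_span S f -> representer_span S (fun x => a * f x).
Proof.
move=> [s sS ->]; exists [seq (a * i.1, i.2) | i <- s].
  by move=> _ /mapP[j /sS Sj ->].
apply/funext => x; rewrite /atomic_comb big_map mulr_sumr.
by apply: eq_bigr => i _; rewrite mulrA.
Qed.

Lemma representer_span1 S x : S x -> representer_span S (phi x).
Proof.
move=> Sx; exists [:: (1, x)]; first by move=> i /[!inE] /eqP->.
by apply/funext => y; rewrite /atomic_comb big_seq1 mul1r.
Qed.

Lemma representer_spanS S T f :
  S `<=` T -> representer_span S f -> representer_span T f.
Proof. by move=> ST [s sS ->]; exists s => // i /sS /ST. Qed.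

Lemma ip_vanishing S f v : H f -> (forall x, S x -> f x = 0) ->
  representer_span S v -> ip H v f = 0.
Proof.
move=> Hf f0 [s sS ->]; rewrite ip_atomic_comb // big_seq big1 // => i /sS Si.
by rewrite ip_representer // f0 // sconj0 mulr0.
Qed.

(** Testing against [f x] times [phi x] produces the squared modulus of [f x], so orthogonality of
    real parts suffices over the complex scalars too. *)
Lemma orthogonal_vanishes S f x : H f ->
  (forall v, representer_span S v -> reip (H := H) f v = 0) -> S x -> f x = 0.
Proof.
move=> Hf fS Sx; apply: sre_conjM_eq0; rewrite mulrC.
have Wv := representer_spanZ (f x) (representer_span1 Sx).
rewrite -(fS _ Wv) reipC //; last exact: representer_span_rkhs Wv.
by rewrite /reip ipZ ?ip_representer //; exact: representer_rkhs.
Qed.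

(* Gram-Schmidt: [w] below is [phi y] minus its projection on the other
   representers, and it vanishes at [y] only if it is zero. *)
Lemma interpolation (xs : seq X) f : H f -> exists2 q,
  representer_span [set` xs] q & forall x, x \in xs -> q x = f x.
Proof.
elim: xs f => [|y xs IHxs] f Hf.
  by exists (fun=> 0) => //; exact: representer_span0.
have sub : [set` xs] `<=` [set` y :: xs].
  by move=> x /=; rewrite inE => ->; rewrite orbT.
have Hy := representer_rkhs y.
have [q Wq qf] := IHxs _ Hf; have [r Wr ry] := IHxs _ Hy.
have Hq := representer_span_rkhs Wq; have Hr := representer_span_rkhs Wr.
pose w := phi y \- r; have Hw : H w := rkhsB Hy Hr.
have w0 x : x \in xs -> w x = 0 by move=> xxs; rewrite /w /= ry // subrr.
have [wy0|wy0] := eqVneq (w y) 0.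
  have phiE : phi y = r.
    (* [r] combines representers at [xs], where [w] vanishes, so [ip H w w] reduces to the conjugate
       of [w y]. *)
    have {}w0 : w = fun=> 0.
      apply: (ip_eq0 Hw); rewrite ipBl // ip_representer // wy0 sconj0 sub0r.
      by rewrite (ip_vanishing (S := [set` xs])) ?oppr0.
    by apply/funext => x; apply: subr0_eq; exact: (congr1 (@^~ x) w0).
  exists q; first exact: representer_spanS Wq.
  (* [q \- f] vanishes on [xs], hence is orthogonal to [r], which is [phi y]: the value at [y] is
     already right. *)
  move=> x /[!inE] /predU1P[->|]; last exact: qf.
  have Hqf := rkhsB Hq Hf.
  apply/eqP; rewrite -subr_eq0 -[_ - _]/((q \- f) y) (phiP y).2 // phiE ipC //.
  rewrite (ip_vanishing (S := [set` xs])) ?sconj0 // => x' x'xs.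
  by rewrite /= qf ?subrr.
have Ww : representer_span [set` y :: xs] w.
  rewrite /w sub_funE; apply: representer_spanD.
    by apply: representer_span1; rewrite /= inE eqxx.
  by apply: representer_spanZ; exact: representer_spanS Wr.
exists (q \+ (fun x => (f y - q y) / w y * w x)).
  apply: representer_spanD; first exact: representer_spanS Wq.
  exact: representer_spanZ.
move=> x /[!inE] /predU1P[->|xxs] /=; first by rewrite mulfVK // addrC subrK.
by rewrite (w0 x) // mulr0 addr0 qf.
Qed.

End Representers.

(** Gaussian elimination: with a pivot [e i y != 0], subtracting multiples of [e i] makes the other
    functions vanish at [y], and a combination vanishing at [y] is a combination of these [n] new
    functions. Without a pivot every [e i] vanishes on [S]. *)
Lemma determining_points (K : fieldType) (X : choiceType) (S : set X) n
    (e : 'I_n -> X -> K) :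
  exists2 xs : seq X, (forall x, x \in xs -> S x) &
    forall a : 'I_n -> K, (forall x, x \in xs -> \sum_i a i * e i x = 0) ->
      forall x, S x -> \sum_i a i * e i x = 0.
Proof.
elim: n e => [|n IHn] e; first by exists [::] => // a _ x _; rewrite big_ord0.
have [[i [y [Sy ey0]]]|e0] := pselect (exists i x, S x /\ e i x != 0); last first.
  exists [::] => // a _ x Sx; rewrite big1 // => i _; apply/eqP.
  rewrite mulf_eq0; apply/orP; right; apply/negPn/negP => eix.
  by apply: e0; exists i, x.
have [xs xsS xsP] := IHn (fun j x =>
  e (lift i j) x - e (lift i j) y / e i y * e i x).
exists (y :: xs) => [x /[!inE] /predU1P[->//|]|a a0]; first exact: xsS.
have ay0 : \sum_i a i * e i y = 0 by apply: a0; rewrite inE eqxx.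
have aE x : \sum_i a i * e i x = \sum_j a (lift i j) *
    (e (lift i j) x - e (lift i j) y / e i y * e i x).
  (* The subtracted term is zero by [ay0]; it cancels the index [i]. *)
  transitivity (\sum_i a i * e i x - (\sum_i a i * e i y) * (e i x / e i y)).
    by rewrite ay0 mul0r subr0.
  rewrite !(bigD1_ord i) //= mulrDl mulr_suml opprD addrACA -sumrB.
  rewrite -mulrA [e i y * _]mulrC divfK // subrr add0r.
  by apply: eq_bigr => j _; field.
by move=> x Sx; rewrite aE; apply: xsP => // z zxs; rewrite -aE a0 // inE zxs orbT.
Qed.

(** * Integration against finite sums of point masses *)

Section AtomicIntegrals.
Context {d : measure_display} {T : measurableType d} {R : realType}.
Implicit Types (s : seq ({nonneg R} * T)) (v : T -> R).

Fixpoint atoms s : {measure set T -> \bar R} :=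
  if s is i :: s then measure_add (mscale i.1 (dirac i.2)) (atoms s) else mzero.

Lemma atomsE s A : measurable A ->
  atoms s A = (\sum_(i <- s) i.1%:num * (i.2 \in A)%:R)%:E.
Proof.
move=> mA; elim: s => [|i s IHs]; first by rewrite big_nil.
rewrite big_cons EFinD -IHs; transitivity (mscale i.1 (dirac i.2) A + atoms s A)%E.
  exact: measure_addE.
by rewrite /mscale /= diracE.
Qed.

Lemma integral_atoms s v : measurable_fun setT v -> (forall x, 0 <= v x) ->
  (\int[atoms s]_x (v x)%:E)%E = (\sum_(i <- s) i.1%:num * v i.2)%:E.
Proof.
move=> mv v0; have /measurable_EFinP mEv := mv.
have v0E x : (setT x -> 0 <= (v x)%:E)%E by rewrite lee_fin.
elim: s => [|i s IHs]; first by rewrite big_nil integral_measure_zero.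
rewrite big_cons EFinD -IHs [LHS]ge0_integral_measure_add //.
congr (_ + _)%E; rewrite ge0_integral_mscale // integral_dirac //.
by rewrite diracE in_setT mul1e.
Qed.

(* The negative weights are moved to the side of [m], so that both sides are
   measures. *)
Lemma ge0_integral_signed_atoms (m : {measure set T -> \bar R})
    (s : seq (R * T)) v :
  (forall A, measurable A -> m A = (\sum_(i <- s) i.1 * (i.2 \in A)%:R)%:E) ->
  measurable_fun setT v -> (forall x, 0 <= v x) ->
  (\int[m]_x (v x)%:E)%E = (\sum_(i <- s) i.1 * v i.2)%:E.
Proof.
move=> mE mv v0; have /measurable_EFinP mEv := mv.
have max0 (b : R) : 0 <= Num.max b 0 by rewrite le_max lexx orbT.
pose pos := [seq (NngNum (max0 i.1), i.2) | i <- s].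
pose neg := [seq (NngNum (max0 (- i.1)), i.2) | i <- s].
have posnegE (c : T -> R) : \sum_(i <- s) i.1 * c i.2 =
    \sum_(i <- pos) i.1%:num * c i.2 - \sum_(i <- neg) i.1%:num * c i.2.
  rewrite !big_map -sumrB; apply: eq_bigr => i _ /=.
  rewrite -mulrBl; congr (_ * _).
  by have [?|?] := leP i.1 0; have [?|?] := leP (- i.1) 0; lra.
have v0E x : (setT x -> 0 <= (v x)%:E)%E by rewrite lee_fin.
have : (\int[measure_add m (atoms neg)]_x (v x)%:E = \int[atoms pos]_x (v x)%:E)%E.
  apply: eq_measure_integral => A mA _; rewrite [LHS]measure_addE.
  by rewrite mE // !atomsE // -EFinD (posnegE (fun x => (x \in A)%:R)) subrK.
rewrite ge0_integral_measure_add // !integral_atoms // posnegE.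
move=> E; rewrite EFinB -E addeK //.
Qed.

(** Signed weights occur although [m] is a measure, since a point may be repeated in [s] with
    opposite signs; the Jordan parts below arise in this form. *)
Lemma Rintegral_signed_atoms (m : {measure set T -> \bar R})
    (s : seq (R * T)) v :
  (forall A, measurable A -> m A = (\sum_(i <- s) i.1 * (i.2 \in A)%:R)%:E) ->
  measurable_fun setT v ->
  Rintegral m setT v = \sum_(i <- s) i.1 * v i.2.
Proof.
move=> mE mv; rewrite /Rintegral integralE.
have [mp mn] : measurable_fun setT (v^\+)%R /\ measurable_fun setT (v^\-)%R.
  by split; [exact: measurable_funrpos|exact: measurable_funrneg].
rewrite funerpos funerneg.
rewrite !(ge0_integral_signed_atoms mE) //= -?sumrB.
apply: eq_bigr => i _; rewrite -mulrBr; congr (_ * _).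
exact: (congr1 (@^~ i.2) (funrposBneg v)).
Qed.

End AtomicIntegrals.

(** * Atomic scalar measures: additivity, support and integrals *)

Section AtomicMeasures.
Context {R : realType} {k : scalar_kind} {X : ptopologicalType}.
Local Notation F := (scalar_field R k).
Implicit Types (s : seq (F * X)) (A : set (borel X)).

Definition atomic_value s A : F := \sum_(i <- s) i.1 * (i.2 \in A)%:R.

Lemma atomic_value0 s : atomic_value s set0 = 0.
Proof. by rewrite /atomic_value big1 // => i _; rewrite in_set0 mulr0. Qed.

(** By disjointness at most one [A j] contains [x], so the partial sums are eventually constant. *)
Lemma cvg_mem_bigcup (x : X) (A : (set X)^nat) : trivIset setT A ->
  (fun n => \sum_(0 <= j < n) (x \in A j)%:R) @ \oo -->
  ((x \in \bigcup_j A j)%:R : F).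
Proof.
move=> tA; apply: cvg_near_cst.
have [|xA] := boolP (x \in \bigcup_j A j).
  move=> /set_mem[m _ xm]; exists m.+1 => // n /= mn.
  rewrite (bigD1_seq m) ?mem_index_iota ?iota_uniq //= mem_set // big1 ?addr0 //.
  move=> j jm; case: (boolP (x \in A j)) => // /set_mem xj.
  by move/eqP: jm; case; apply: tA => //; exists x.
apply: nearW => n; rewrite big1 // => j _.
case: (boolP (x \in A j)) => // /set_mem xj.
by move/negP: xA; case; apply/mem_set; exists j.
Qed.

Lemma atomic_value_sigma_additive s (A : (set (borel X))^nat) :
  (forall n, measurable (A n)) -> trivIset setT A ->
  (fun n => \sum_(0 <= i < n) atomic_value s (A i)) @ \oo -->
  atomic_value s (\bigcup_n A n).
Proof.
move=> _ tA.
pose hits (i : F * X) n : F := \sum_(0 <= j < n) (i.2 \in A j)%:R.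
rewrite (_ : (fun n => _) = (fun n => \sum_(i <- s) i.1 * hits i n)); last first.
  apply/funext => n; rewrite /atomic_value exchange_big /=.
  by apply: eq_bigr => i _; rewrite mulr_sumr.
rewrite /atomic_value; elim: s => [|i s IHs].
  rewrite big_nil (_ : (fun n => _) = cst 0); first exact: cvg_cst.
  by apply/funext => n; rewrite big_nil.
rewrite big_cons (_ : (fun n => _) =
    (fun n => i.1 * hits i n + \sum_(j <- s) j.1 * hits j n)); last first.
  by apply/funext => n; rewrite big_cons.
by apply: cvgD IHs; apply: cvgM; [exact: cvg_cst|exact: cvg_mem_bigcup].
Qed.

Definition atomic_fmeasure s : fmeasure R k X :=
  FMeasure (atomic_value0 s) (@atomic_value_sigma_additive s).

(** The open complement of [S] contains no atom, so all pieces of its partitions have value 0 and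
    its variation is 0. *)
Lemma supp_atomic_fmeasure s (S : set X) : closed S ->
  (forall i, i \in s -> S i.2) -> supp (fvariation (atomic_fmeasure s)) `<=` S.
Proof.
move=> clS sS x xs; apply: contrapT => nSx.
have := xs (~` S); rewrite openC => /(_ clS nSx); apply/negP; rewrite -leNgt.
apply: ub_ereal_sup => _ [E [mE tE EU] <-].
rewrite eseries0 // => j _ _; congr EFin; rewrite -[RHS](@smod0 R k); congr smod.
rewrite /= /atomic_value big_seq big1 // => i /sS Si.
case: (boolP (i.2 \in E j)) => [/set_mem Ej|_]; last by rewrite mulr0.
by have : (~` S) i.2 by rewrite -EU; exists j.
Qed.

(** The Jordan parts are, up to sign, the restrictions of [nu] to the Hahn sets, hence again atomic;
    each atom lies in exactly one of these sets and is counted once. *)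
Lemma charge_integral_atomic (nu : {charge set (borel X) -> \bar R})
    (s : seq (R * X)) (u : X -> R) :
  (forall A, measurable A -> nu A = (\sum_(i <- s) i.1 * (i.2 \in A)%:R)%:E) ->
  measurable_fun [set: borel X] (u : borel X -> R) ->
  charge_integral nu u = \sum_(i <- s) i.1 * u i.2.
Proof.
move=> nuE mu_; rewrite /charge_integral.
have [[mP _] [mN _] PN PN0] := hahnP nu.
have posE A : measurable A -> jordan_pos (hahnP nu) A =
    (\sum_(i <- [seq (i.1 * (i.2 \in hahn_pos nu)%:R, i.2) | i <- s])
       i.1 * (i.2 \in A)%:R)%:E.
  move=> mA; rewrite [LHS]jordan_posE cjordan_posE /crestr0 mem_set //= /crestr.
  rewrite nuE; last exact: measurableI.
  rewrite big_map; congr EFin; apply: eq_bigr => i _ /=.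
  by rewrite in_setI andbC; case: (_ \in _); case: (_ \in _);
    rewrite ?mulr1 ?mulr0.
have negE A : measurable A -> jordan_neg (hahnP nu) A =
    (\sum_(i <- [seq (- (i.1 * (i.2 \in hahn_neg nu)%:R), i.2) | i <- s])
       i.1 * (i.2 \in A)%:R)%:E.
  move=> mA; rewrite [LHS]jordan_negE cjordan_negE /crestr0 mem_set //= /crestr.
  rewrite nuE; last exact: measurableI.
  rewrite big_map -EFinN -sumrN; congr EFin; apply: eq_bigr => i _ /=.
  by rewrite in_setI andbC; case: (_ \in _); case: (_ \in _);
    rewrite ?mulr1 ?mulr0 ?oppr0.
rewrite (Rintegral_signed_atoms posE) // (Rintegral_signed_atoms negE) //.
rewrite !big_map -sumrB; apply: eq_bigr => i _ /=.
rewrite -mulrBl opprK -mulrDr -natrD; congr (_ * _).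
suff -> : ((i.2 \in hahn_pos nu) + (i.2 \in hahn_neg nu))%N = 1%N by rewrite mulr1.
have : i.2 \in hahn_pos nu `|` hahn_neg nu by rewrite PN in_setT.
have : i.2 \notin hahn_pos nu `&` hahn_neg nu by rewrite PN0 in_set0.
by rewrite in_setI in_setU; case: (_ \in hahn_pos nu); case: (_ \in hahn_neg nu).
Qed.

Lemma fintegral_atomic s (u : X -> F) :
  measurable_fun [set: borel X] ((@sre R k \o u) : borel X -> R) ->
  measurable_fun [set: borel X] ((@sim R k \o u) : borel X -> R) ->
  fintegral (atomic_fmeasure s) u = \sum_(i <- s) i.1 * u i.2.
Proof.
move=> mre mim; rewrite /fintegral.
have reE A : measurable A -> fmeas_re (atomic_fmeasure s) A =
    (\sum_(i <- [seq (sre i.1, i.2) | i <- s]) i.1 * (i.2 \in A)%:R)%:E.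
  move=> _; rewrite /fmeas_re big_map; congr EFin.
  rewrite /= /atomic_value (big_morph _ (@sreD R k) (@sre0 R k)).
  by apply: eq_bigr => i _; case: (_ \in A); rewrite ?mulr1 ?mulr0 ?sre0.
have imE A : measurable A -> fmeas_im (atomic_fmeasure s) A =
    (\sum_(i <- [seq (sim i.1, i.2) | i <- s]) i.1 * (i.2 \in A)%:R)%:E.
  move=> _; rewrite /fmeas_im big_map; congr EFin.
  rewrite /= /atomic_value (big_morph _ (@simD R k) (@sim0 R k)).
  by apply: eq_bigr => i _; case: (_ \in A); rewrite ?mulr1 ?mulr0 ?sim0.
rewrite !(charge_integral_atomic reE) // !(charge_integral_atomic imE) //.
rewrite !big_map -sumrB -big_split /=.
rewrite -[RHS]mkscalarE (big_morph _ (@sreD R k) (@sre0 R k)).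
rewrite (big_morph _ (@simD R k) (@sim0 R k)).
by congr mkscalar; apply: eq_bigr => i _; rewrite ?sreM ?simM.
Qed.

Lemma measurable_continuous_comp (f : X -> F) (h : F -> R) : continuous h ->
  measurable_fun [set: borel X] (f : borel X -> borel F) ->
  measurable_fun [set: borel X] ((h \o f) : borel X -> R).
Proof.
move=> ch mf; apply: (measurability _ (RGenOInfty.measurableE R)).
move=> _ [_ [x ->] <-]; rewrite comp_preimage; apply: mf => //.
by apply: sub_sigma_algebra; move/continuousP : ch; apply; exact: interval_open.
Qed.

Lemma continuous_sre : continuous (@sre R k).
Proof.
move=> z; apply/(@cvgrPdist_lt _ _ _ (nbhs z) (nbhs_filter z)) => e e0.
have : id w @[w --> z] --> z by exact: cvg_id.
move/(@cvgrPdist_lt _ _ _ (nbhs z) (nbhs_filter z))/(_ _ (of_real_gt0 k e0)).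
by apply: filterS => w; exact: sre_contract.
Qed.

Lemma continuous_sim : continuous (@sim R k).
Proof.
move=> z; apply/(@cvgrPdist_lt _ _ _ (nbhs z) (nbhs_filter z)) => e e0.
have : id w @[w --> z] --> z by exact: cvg_id.
move/(@cvgrPdist_lt _ _ _ (nbhs z) (nbhs_filter z))/(_ _ (of_real_gt0 k e0)).
by apply: filterS => w; exact: sim_contract.
Qed.

End AtomicMeasures.

(** * The complement of the support is a null set *)

Section Support.
Context {R : realType} {X : ptopologicalType}.

Lemma open_setC_supp (m : set (borel X) -> \bar R) : open (~` supp m).
Proof.
rewrite openE => x /existsNP[U /not_implyP[oU /not_implyP[Ux mU]]].
by rewrite /interior /= nbhsE; exists U => // y Uy /(_ U oU Uy).
Qed.

Lemma closed_supp (m : set (borel X) -> \bar R) : closed (supp m).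
Proof. by rewrite -openC; exact: open_setC_supp. Qed.

(** Balls with centers in a countable dense set and radii [eps m] form a countable base, and those
    of measure zero cover the complement of the support. *)
Lemma supp_conull (mu : {measure set (borel X) -> \bar R}) : polish R X ->
  mu (~` supp mu) = 0%E.
Proof.
move=> [[D [cD dD]] [dist [dist0 distC tri nbhs_dist _]]].
pose b x (e : R) := [set y | dist x y < e].
have b_open x e : open (b x e).
  rewrite openE => y xy; rewrite /interior /= nbhs_dist.
  exists (e - dist x y); first by rewrite /= subr_gt0.
  by move=> z yz; apply: le_lt_trans (tri _ y _) _; rewrite -ltrBrDl.
have mopen (U : set X) : open U -> measurable (U : set (borel X)).
  exact: sub_sigma_algebra.
(* An empty dense set is excluded because [X] is pointed. *)
have [D0|[g]] := pfcard_geP cD.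
  by have [] := dD setT (ex_intro _ point I) openT => x []; rewrite D0.
apply/negligibleP; first exact: mopen (open_setC_supp mu).
pose eps m : R := m.+1%:R^-1; pose B n m := b (g n) (eps m).
pose G n m : set (borel X) := if mu (B n m) == 0%E then B n m else set0.
have : mu.-negligible (\bigcup_n \bigcup_m G n m).
  apply: negligible_bigcup => n; apply: negligible_bigcup => m.
  rewrite /G; case: eqP => [Bnm|_]; last exact: negligible_set0.
  by apply/negligibleP; [exact: mopen (b_open (g n) (eps m))|].
apply: negligibleS => y /existsNP[U /not_implyP[oU /not_implyP[Uy]]].
move/negP; rewrite -leNgt => mU.
have : nbhs y U by exact: open_nbhs_nbhs.
rewrite nbhs_dist => -[e /= e0 eU].
have e2 : 0 < e / 2 by rewrite divr_gt0.
(* A ball of radius below [e / 2] whose center is within that radius of [y] stays in the [e]-ball of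
   [y], hence in [U]. *)
have [m _ /(_ m (leqnn m)) me] := near_infty_natSinv_lt (PosNum e2).
have {}me : eps m < e / 2 by exact: me.
have [|x [xy Dx]] := dD (b y (eps m)) _ (b_open _ _).
  by exists y; rewrite /b /= (dist0 y y).2 // invr_gt0 ltr0n.
have [n _ gn] : range g x by exact: (@surj _ _ _ _ g).
exists n => //; exists m => //.
have BU : B n m `<=` U.
  move=> z xz; apply: eU; apply: le_lt_trans (tri _ x _) _.
  by move: xz xy; rewrite /B /b /= gn => xz xy; lra.
have -> : G n m = B n m.
  have oB : open (B n m) := b_open (g n) (eps m).
  rewrite /G ifT //; apply/eqP/le_anti; rewrite measure_ge0 andbT.
  by apply: le_trans mU; apply: le_measure;
    [rewrite inE; exact: mopen oB|rewrite inE; exact: mopen oU|].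
by change (is_true (dist (g n) y < eps m)); rewrite gn distC.
Qed.

End Support.

Import HBNNSimple.

Lemma integral_eq_off_null d (T : measurableType d) (R : realType)
    (m : {measure set T -> \bar R}) (N : set T) (v w : T -> \bar R) :
  measurable N -> m N = 0%E ->
  (forall x, 0 <= v x)%E -> (forall x, 0 <= w x)%E ->
  (forall x, ~ N x -> v x = w x) ->
  (\int[m]_x v x = \int[m]_x w x)%E.
Proof.
move=> mN N0.
have mNC : measurable (~` N) by exact: measurableC.
suff le (v' w' : T -> \bar R) : (forall x, 0 <= v' x)%E -> (forall x, 0 <= w' x)%E ->
    (forall x, ~ N x -> v' x = w' x) -> (\int[m]_x v' x <= \int[m]_x w' x)%E.
  by move=> v0 w0 vw; apply/le_anti; rewrite !le // => x /vw.
move=> v0 w0 vw; rewrite !ge0_integralE // !patch_setT.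
apply: ub_ereal_sup => _ [h hv <-]; pose h' := proj_nnsfun h mNC.
have -> : sintegral m h = sintegral m h'.
  rewrite -!integralT_nnsfun.
  rewrite [LHS](@ge0_negligible_integral _ _ _ _ _ N) //; last 2 first.
  - exact/measurable_EFinP.
  - by move=> x _; rewrite lee_fin.
  rewrite [RHS](@ge0_negligible_integral _ _ _ _ _ N) //; last 2 first.
  - exact/measurable_EFinP.
  - by move=> x _; rewrite lee_fin.
  apply: eq_integral => x /set_mem[_ Nx].
  by rewrite /= mindicE mem_set // mulr1.
apply: ereal_sup_ubound; exists h' => // x /=.
rewrite mindicE; case: (boolP (x \in ~` N)) => [/set_mem Nx|_].
  by rewrite mulr1 -vw.
by rewrite mulr0.
Qed.

(** * Atomic Pettis integrals and the optimality argument *)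

Section Optimizer.
Context {R : realType} {k : scalar_kind} {X : ptopologicalType}
  {H : rkhs R k X}.
Local Notation F := (scalar_field R k).
Variable phi : X -> X -> F.
Hypotheses (phiP : is_feature_map H phi)
  (borelH : forall f, H f ->
     measurable_fun [set: borel X] (f : borel X -> borel F)).

Lemma pettis_integral_atomic (s : seq (F * X)) :
  (\int[fvariation (atomic_fmeasure s)]_x (hnorm H (phi x))%:E < +oo)%E ->
  is_pettis_integral H phi (atomic_fmeasure s) (atomic_comb phi s).
Proof.
move=> fin; split => [//||f Hf]; first exact: (atomic_comb_rkhs phiP).
have phifE x : ip H (phi x) f = sconj (f x) by exact: ip_representer.
have mf := borelH Hf.
have mre := measurable_continuous_comp (@continuous_sre R k) mf.
have mim := measurable_continuous_comp (@continuous_sim R k) mf.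
rewrite (ip_atomic_comb phiP) // fintegral_atomic //.
  rewrite (_ : _ \o _ = @sre R k \o f) //.
  by apply/funext => x /=; rewrite phifE sre_conj.
rewrite (_ : _ \o _ = \- (@sim R k \o f)); first exact: measurable_funN.
by apply/funext => x /=; rewrite phifE sim_conj.
Qed.

(** Serves both halves of the theorem: [q] is the projection in one and the interpolant in the
    other. *)
Lemma optimizer_eq (mu : probability (borel X) R) (p lambda : R)
    (c : F -> F -> R) (g fhat q : X -> F) :
  polish R X -> 0 < p -> 0 < lambda -> (forall w z, 0 <= c w z) ->
  mu.-integrable [set: borel X] (fun x => (c 0 (g x))%:E) ->
  is_optimizer H mu c g lambda p fhat -> H q ->
  (forall x, supp mu x -> q x = fhat x) ->
  reip (H := H) (fhat \- q) q = 0 -> q = fhat.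
Proof.
move=> polishX p0 lambda0 c0 c0g [Hf fopt] Hq qf fqq.
have intE : (\int[mu]_x (c (fhat x) (g x))%:E = \int[mu]_x (c (q x) (g x))%:E)%E.
  apply: (@integral_eq_off_null _ (borel X) R mu (~` supp mu)) => [|||x|x Nx].
  - by apply: sub_sigma_algebra; exact: open_setC_supp.
  - exact: supp_conull.
  - by move=> x; rewrite lee_fin.
  - by rewrite lee_fin.
  - by rewrite qf //; exact: contrapT.
(* Comparison with the zero function bounds the data term; finiteness is what allows cancelling it
   to compare the norms. *)
have int_fin : (\int[mu]_x (c (fhat x) (g x))%:E)%E \is a fin_num.
  rewrite ge0_fin_numE; last by apply: integral_ge0 => x _; rewrite lee_fin.
  have pen0 : (0 <= (lambda * hnorm H fhat `^ p)%:E)%E.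
    by rewrite lee_fin mulr_ge0 ?powR_ge0 // ltW.
  apply: le_lt_trans (leeDl _ pen0) _.
  apply: le_lt_trans (fopt _ (@rkhs0 _ _ _ H)) _.
  rewrite /objective lte_add_pinfty ?ltry //.
  by have /integrableP[_] := c0g; under eq_integral do rewrite gee0_abs ?lee_fin //.
have norm_le : hnorm H fhat <= hnorm H q.
  have := fopt _ Hq; rewrite /objective -intE leeD2lE // lee_fin ler_pM2l //.
  rewrite leNgt; apply: contraNle => lt_qf.
  by rewrite gt0_ltr_powR // nnegrE sqrtr_ge0.
have sqr_le : reip (H := H) fhat fhat <= reip (H := H) q q.
  by rewrite -!sqr_hnorm // ler_pXn2r // nnegrE sqrtr_ge0.
have Hfq := rkhsB Hf Hq.
(* Pythagoras: orthogonality makes this [reip fhat fhat - reip q q], which is at most 0. *)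
have fq0 : reip (H := H) (fhat \- q) (fhat \- q) = 0.
  apply/eqP; rewrite eq_le reip_ge0 // andbT.
  move: fqq; rewrite reipBB // reipBl //; lra.
apply/esym/funext => x; apply: subr0_eq.
exact: (congr1 (@^~ x) (reip_eq0 Hfq fq0)).
Qed.

End Optimizer.

Unset Implicit Arguments.

Theorem theorem3p2 (R : realType) (k : scalar_kind) (X : ptopologicalType)
  (polishX : polish R X)
  (H : rkhs R k X) (phi : X -> X -> scalar_field R k)
  (phiP : is_feature_map H phi)
  (borelH : forall f, H f ->
     measurable_fun [set: borel X] (f : borel X -> borel (scalar_field R k)))
  (mu : probability (borel X) R)
  (p lambda : R) (p_gt1 : 1 < p) (lambda_gt0 : 0 < lambda)
  (g : X -> scalar_field R k)
  (borelg : measurable_fun [set: borel X] (g : borel X -> borel (scalar_field R k)))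
  (c : scalar_field R k -> scalar_field R k -> R)
  (c_ge0 : forall w z, 0 <= c w z)
  (borelc : measurable_fun [set: borel (scalar_field R k * scalar_field R k)%type]
     ((fun wz => c wz.1 wz.2) : borel (scalar_field R k * scalar_field R k)%type -> R))
  (c0g_L1 : mu.-integrable [set: borel X] (fun x => (c 0 (g x))%:E))
  (c_lsc : forall z, lower_semicontinuous (fun w => (c w z)%:E))
  (c_convex : forall z, convex_fun (fun w => c w z))
  (fhat : X -> scalar_field R k)
  (fhat_opt : is_optimizer H mu c g lambda p fhat)
  (phi_int : forall xi : fmeasure R k X, supp (fvariation xi) `<=` supp mu ->
     (\int[fvariation xi]_x (hnorm H (phi x))%:E < +oo)%E) :
  (exists nu : nat -> fmeasure R k X,
     (forall n, supp (fvariation (nu n)) `<=` supp mu) /\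
     exists2 h : nat -> X -> scalar_field R k,
       forall n, is_pettis_integral H phi (nu n) (h n) &
       (fun n => hnorm H (fhat \- h n)) @ \oo --> (0 : R)) /\
  (finite_set (supp mu) \/ finite_dimensional H ->
   exists2 nu : fmeasure R k X,
     supp (fvariation nu) `<=` supp mu & is_pettis_integral H phi nu fhat).

Proof.
have p0 : 0 < p by exact: lt_trans p_gt1.
have [Hf _] := fhat_opt.
have opt := optimizer_eq polishX p0 lambda_gt0 c_ge0 c0g_L1 fhat_opt.
have nu_supp s : (forall i, i \in s -> supp mu i.2) ->
    supp (fvariation (@atomic_fmeasure R k X s)) `<=` supp mu.
  by apply: supp_atomic_fmeasure; exact: closed_supp.
have nu_pettis s : (forall i, i \in s -> supp mu i.2) ->
    is_pettis_integral H phi (atomic_fmeasure s) (atomic_comb phi s).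
  by move=> /nu_supp/phi_int; exact: pettis_integral_atomic.
split.
  have [u [q [Wu Hq uq qW qq]]] := projection
    (@representer_span_rkhs _ _ _ _ _ phiP (supp mu))
    (representer_span0 phi (supp mu))
    (@representer_spanD _ _ _ phi (supp mu))
    (@representer_spanZ _ _ _ phi (supp mu)) Hf.
  have qf : q = fhat.
    apply: opt => // x Sx; apply/esym/subr0_eq.
    exact: (orthogonal_vanishes phiP (rkhsB Hf Hq) qW Sx).
  have /boolp.choice[s sP] : forall n, exists s : seq (scalar_field R k * X),
      (forall i, i \in s -> supp mu i.2) /\ u n = atomic_comb phi s.
    by move=> n; have [s ? ?] := Wu n; exists s.
  exists (fun n => atomic_fmeasure (s n)); split.
    by move=> n; apply: nu_supp; exact: (sP n).1.
  exists u; first by move=> n; rewrite (sP n).2; apply: nu_pettis; exact: (sP n).1.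
  rewrite (_ : (fun n => _) = (fun n => hnorm H (u n \- q))) //.
  apply/funext => n; rewrite qf hnormBC //.
  exact: (representer_span_rkhs phiP (Wu n)).
move=> fin.
(* The points are the whole support when it is finite, and determining points of a spanning family
   when [H] is finite-dimensional. *)
have [xs xsS xsP] : exists2 xs : seq X, (forall x, x \in xs -> supp mu x) &
    forall f, H f -> (forall x, x \in xs -> f x = 0) ->
      forall x, supp mu x -> f x = 0.
  case: fin => [/finite_seqP[xs suppE]|[n [e [He espan]]]].
    by exists xs => [x|f _ f0 x]; rewrite suppE //=; exact: f0.
  have [xs xsS xsP] := determining_points (supp mu) e.
  exists xs => // f Hf' f0; have [a fE] := espan f Hf'.
  by move=> x Sx; rewrite fE; apply: xsP => // y /f0; rewrite fE.
have [q [s sxs qE] qf] := interpolation phiP xs Hf.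
have Hq : H q by rewrite qE; exact: (atomic_comb_rkhs phiP).
have Hfq := rkhsB Hf Hq.
have fq0 x : x \in xs -> (fhat \- q) x = 0 by move=> /qf /= ->; rewrite subrr.
(* [fhat \- q] vanishes at [xs], hence on the support by [xsP], and it is orthogonal to the span of
   the representers at [xs], which contains [q]. *)
have <- : q = fhat.
  apply: opt => // [x Sx|].
    by apply/esym/subr0_eq; exact: (xsP _ Hfq fq0 x Sx).
  rewrite reipC // /reip (ip_vanishing phiP (S := [set` xs])) ?sre0 //.
  by exists s.
have sS i : i \in s -> supp mu i.2 by move=> /sxs; exact: xsS.
by exists (atomic_fmeasure s); [exact: nu_supp|rewrite qE; exact: nu_pettis].
Qed.
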